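(* Let $\eta\in(0,1)$. There exist constants $c,C_1,C,C'>0$ depending only on $\eta$ such that for every $d\ge1$ and every $\sigma_1\ge\dots\ge\sigma_d>0$ with $\Sigma=\operatorname{diag}(\sigma_1^2,\dots,\sigma_d^2)$, with $\lambda$ and $\nu$ defined in the context, the following hold. (i) For every $s\in\{1,\dots,d\}$, $\ c(\lambda+\nu)\le\epsilon^*(s,\infty,\Sigma)\le C_1(\lambda+\nu)$. (ii) The test $\psi^*=\mathbf 1\{\max_{j\in[d]}|X_j|>C(\lambda+\nu)\}$ satisfies $$\mathbb P_0(\psi^*=1)\le\eta/2,\qquad\text{and}\qquad \mathbb P_\theta(\psi^*=0)\le\eta/2\ \text{ for every }\theta\in\mathbb R^d\text{ with }\|\theta\|_\infty\ge C'(\lambda+\nu).$$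
   Context: Testing problem. Let $d\ge1$, $[d]=\{1,\dots,d\}$, $\sigma_1\ge\dots\ge\sigma_d>0$ known, $\Sigma=\operatorname{diag}(\sigma_1^2,\dots,\sigma_d^2)$. For $\theta\in\mathbb R^d$, $\mathbb P_\theta$ denotes the law of $X\sim\mathcal N(\theta,\Sigma)$. $\|u\|_\infty=\max_j|u_j|$, $\|u\|_0=\operatorname{Card}\{j:u_j\ne0\}$. For $\epsilon>0$, $s\in[d]$: $\Theta(\epsilon,s,\infty)=\{\theta\in\mathbb R^d:\|\theta\|_\infty\ge\epsilon,\ \|\theta\|_0\le s\}$. A test is a measurable $\psi:\mathbb R^d\to\{0,1\}$ of $X$; its risk is $R(\psi,\epsilon,s,\infty,\Sigma)=\mathbb P_0(\psi=1)+\sup_{\theta\in\Theta(\epsilon,s,\infty)}\mathbb P_\theta(\psi=0)$; $R^*=\inf_\psi R$ over all tests; $\epsilon^*(s,\infty,\Sigma)=\inf\{\epsilon>0:R^*(\epsilon,s,\infty,\Sigma)\le\eta\}$. Parameters. Let $\beta\in\mathbb R$ be the unique solution of $$\frac{\sum_{j=1}^d\sigma_j^2e^{-\beta/\sigma_j^2}}{\sqrt{\sum_{j=1}^d\sigma_j^4e^{-\beta/\sigma_j^2}}}=\frac12,$$ $\lambda=\sqrt{\max(\beta,0)}$ and $\nu=\big[\sum_{j=1}^d\sigma_j^4e^{-\lambda^2/\sigma_j^2}\big]^{1/4}$. *)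

(* Defs.v *)
From HB Require Import structures.
From mathcomp Require Import all_boot all_order all_algebra.
From mathcomp Require Import all_classical all_reals all_analysis.
From mathcomp Require Import measurable_realfun ring lra.

Set Implicit Arguments.
Unset Strict Implicit.
Unset Printing Implicit Defensive.

Import Order.TTheory GRing.Theory Num.Theory.
Import numFieldNormedType.Exports.

Local Open Scope classical_set_scope.
Local Open Scope ring_scope.

(* The real vector space of dimension d is [d.-tuple R], whose sigma-algebra
   (generated by the coordinate maps) is the Borel one. *)

(* [normal_prob] is a measure on [measurableTypeR R], a copy of R carrying the
   same Borel sigma-algebra under another display. *)
Definition tuple_cons (R : realType) (d : nat)
    (xy : measurableTypeR R * d.-tuple R) : d.+1.-tuple R :=
  [tuple of (xy.1 : R) :: xy.2].

Lemma measurable_tuple_cons (R : realType) (d : nat) :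
  measurable_fun [set: measurableTypeR R * d.-tuple R] (@tuple_cons R d).
Proof.
apply: (@measurable_cons _ _ _ R); [exact: measurable_fst|].
exact: measurable_snd.
Qed.

HB.instance Definition _ (R : realType) (d : nat) :=
  isMeasurableFun.Build _ _ _ _ (@tuple_cons R d) (@measurable_tuple_cons R d).

(* Law of N(theta, diag(sigma_1^2, ..., sigma_d^2)): product of the
   one-dimensional laws with mean theta_j and standard deviation sigma_j. *)
Fixpoint gaussian (R : realType) (d : nat) :
    d.-tuple R -> d.-tuple R -> probability (d.-tuple R) R :=
  match d with
  | 0 => fun _ _ => \d_([tuple])
  | d'.+1 => fun theta sigma => distribution
      (normal_prob (thead theta) (thead sigma)
        \x gaussian (behead_tuple theta) (behead_tuple sigma))%E
      (@tuple_cons R d')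
  end.

Lemma gaussian_box (R : realType) (d : nat) (theta sigma : d.-tuple R)
    (A : 'I_d -> set R) :
  (forall j, measurable (A j)) ->
  gaussian theta sigma [set x | forall j, A j (tnth x j)] =
  (\prod_(j < d) normal_prob (tnth theta j) (tnth sigma j) (A j))%E.
Proof.
elim: d theta sigma A => [|d IH] theta sigma A mA /=.
  by rewrite big_ord0 diracE mem_set //; case.
rewrite /distribution /pushforward.
rewrite (_ : _ @^-1` _ =
  A ord0 `*` [set x | forall j, A (lift ord0 j) (tnth x j)]); last first.
  apply/seteqP; split => -[x y] /=.
    move=> H; split; first by have := H ord0; rewrite /tuple_cons tnth0.
    by move=> j; have := H (lift ord0 j); rewrite /tuple_cons tnthS.
  move=> [H0 H] j.
  by case: (unliftP ord0 j) => [k|] ->; rewrite /tuple_cons ?tnthS ?tnth0.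
rewrite product_measure1E; first last.
- rewrite (_ : [set x | _] = \bigcap_(j in [set: 'I_d])
    ((fun x => tnth x j) @^-1` (A (lift ord0 j)))); last first.
    by apply/seteqP; split => x /= H j; [move=> _|]; apply: H.
  apply: fin_bigcap_measurable => // j _; rewrite -[X in measurable X]setTI.
  exact: measurable_tnth.
- exact: mA.
rewrite big_ord_recl; congr (_ * _)%E.
rewrite [LHS](IH (behead_tuple theta) (behead_tuple sigma)
  (fun j => A (lift ord0 j)) (fun j => mA _)).
apply: eq_bigr => j _.
by rewrite [in RHS](tuple_eta theta) [in RHS](tuple_eta sigma) !tnthS.
Qed.

Definition linf (R : realType) (d : nat) (u : d.-tuple R) : R :=
  \big[Num.max/0]_(j < d) `|tnth u j|.

Definition l0 (R : realType) (d : nat) (u : d.-tuple R) : nat :=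
  #|[pred j | tnth u j != 0]|.

Definition Theta (R : realType) (d : nat) (eps : R) (s : nat)
    : set (d.-tuple R) :=
  [set theta | eps <= linf theta /\ (l0 theta <= s)%N].

Definition test (R : realType) (d : nat) := {mfun d.-tuple R >-> bool}.

Definition risk (R : realType) (d : nat) (sigma : d.-tuple R) (psi : test R d)
    (eps : R) (s : nat) : \bar R :=
  (gaussian (nseq_tuple d 0%R) sigma [set x | psi x = true] +
   ereal_sup [set gaussian theta sigma [set x | psi x = false]
             | theta in Theta eps s])%E.

Definition opt_risk (R : realType) (d : nat) (sigma : d.-tuple R)
    (eps : R) (s : nat) : \bar R :=
  ereal_inf [set risk sigma psi eps s | psi in [set: test R d]].

(* An infimum in \bar R: it is +oo if no eps is admissible. *)
Definition eps_star (R : realType) (d : nat) (sigma : d.-tuple R)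
    (eta : R) (s : nat) : \bar R :=
  ereal_inf [set eps%:E | eps in
    [set eps : R | 0 < eps /\ (opt_risk sigma eps s <= eta%:E)%E]].

Lemma measurable_linf (R : realType) (d : nat) :
  measurable_fun [set: d.-tuple R] (@linf R d).
Proof.
rewrite /linf; elim: (index_enum _) => [|j r IH].
  by under eq_fun do rewrite big_nil; exact: measurable_cst.
under eq_fun do rewrite big_cons.
apply: measurable_maxr => //; apply: measurableT_comp => //.
exact: measurable_tnth.
Qed.

Definition max_test_fun (R : realType) (d : nat) (t : R) (x : d.-tuple R)
    : bool := t < linf x.

Lemma measurable_max_test (R : realType) (d : nat) (t : R) :
  measurable_fun [set: d.-tuple R] (@max_test_fun R d t).
Proof. by apply: measurable_fun_ltr => //; exact: measurable_linf. Qed.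

HB.instance Definition _ (R : realType) (d : nat) (t : R) :=
  isMeasurableFun.Build _ _ _ _ (@max_test_fun R d t)
    (@measurable_max_test R d t).

Definition max_test (R : realType) (d : nat) (t : R) : test R d :=
  @max_test_fun R d t.

Definition beta_ratio (R : realType) (d : nat) (sigma : d.-tuple R) (b : R)
    : R :=
  (\sum_(j < d) tnth sigma j ^+ 2 * expR (- b / tnth sigma j ^+ 2)) /
  Num.sqrt (\sum_(j < d) tnth sigma j ^+ 4 * expR (- b / tnth sigma j ^+ 2)).

Lemma beta_ratio_decr (R : realType) (d : nat) (sigma : d.-tuple R) :
  (1 <= d)%N -> (forall j, 0 < tnth sigma j) ->
  forall b b', b < b' -> beta_ratio sigma b' < beta_ratio sigma b.
Proof.
move=> d1 s0 b b' bb'.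
pose t j := tnth sigma j ^+ 2.
have t0 j : 0 < t j by rewrite exprn_gt0.
pose w j := t j * expR (- b / t j).
pose x j := expR (- (b' - b) / t j).
have w0 j : 0 < w j by rewrite mulr_gt0 ?expR_gt0.
have x0 j : 0 < x j by exact: expR_gt0.
have x1 j : x j < 1.
  by rewrite expR_lt1 mulNr oppr_lt0 divr_gt0 ?subr_gt0.
have wx j : t j * expR (- b' / t j) = w j * x j.
  rewrite /w /x -mulrA -expRD -mulrDl.
  by rewrite (_ : - b - (b' - b) = - b') // opprB addrA addNr add0r.
have t2 j : tnth sigma j ^+ 4 = t j * t j by rewrite /t -exprD.
have -> : beta_ratio sigma b =
    (\sum_j w j) / Num.sqrt (\sum_j w j * t j).
  congr (_ / Num.sqrt _); apply: eq_bigr => j _.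
  by rewrite t2 -mulrA mulrC.
have -> : beta_ratio sigma b' =
    (\sum_j w j * x j) / Num.sqrt (\sum_j w j * x j * t j).
  congr (_ / Num.sqrt _); apply: eq_bigr => j _; rewrite -wx //.
  by rewrite t2 -mulrA mulrC.
have xt i j : t i <= t j -> x i <= x j.
  move=> tij; rewrite /x ler_expR !mulNr lerN2.
  by rewrite ler_pM2l ?subr_gt0 // lef_pV2 ?posrE.
move: t w x t0 w0 x0 x1 xt {wx t2} => t w x t0 w0 x0 x1 xt.
have pos (f : 'I_d -> R) : (forall j, 0 < f j) -> 0 < \sum_j f j.
  move=> f0; rewrite (bigD1 (Ordinal d1)) //= ltr_wpDr //.
  by apply: sumr_ge0 => j _; rewrite ltW.
set W := \sum_j w j; set WX := \sum_j w j * x j.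
set WT := \sum_j w j * t j; set WXT := \sum_j w j * x j * t j.
have W0 : 0 < W by exact: pos.
have WX0 : 0 < WX by apply: pos => j; rewrite mulr_gt0.
have WT0 : 0 < WT by apply: pos => j; rewrite mulr_gt0.
have WXT0 : 0 < WXT by apply: pos => j; rewrite !mulr_gt0.
have WXW : WX < W.
  rewrite -subr_gt0 /W /WX -sumrB; apply: pos => j.
  by rewrite -{1}(mulr1 (w j)) -mulrBr mulr_gt0 ?subr_gt0.
(* Chebyshev's sum inequality *)
have cheb : WX * WT <= W * WXT.
  have : 0 <= \sum_i \sum_j w i * w j * ((x i - x j) * (t i - t j)).
    apply: sumr_ge0 => i _; apply: sumr_ge0 => j _.
    apply: mulr_ge0; first by rewrite mulr_ge0 ?ltW.
    wlog tij : i j / t i <= t j => [H|].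
      have [/H//|/ltW/H] := leP (t i) (t j).
      by rewrite -(opprB (x j)) -(opprB (t j)) mulrNN.
    by rewrite mulr_le0 ?subr_le0 ?xt.
  rewrite (_ : \sum_i _ = (W * WXT - WX * WT) *+ 2).
    by rewrite pmulrn_lge0 // subr_ge0.
  have dbl (f g : 'I_d -> R) :
      (\sum_i f i) * (\sum_j g j) = \sum_i \sum_j f i * g j.
    by rewrite mulr_suml; apply: eq_bigr => i _; rewrite mulr_sumr.
  rewrite mulr2n -{1}(mulrC WXT) -{1}(mulrC WT) /W /WX /WT /WXT !dbl.
  rewrite -!sumrB -big_split; apply: eq_bigr => i _ /=.
  rewrite -!sumrB -big_split; apply: eq_bigr => j _ /=.
  by ring.
rewrite ltr_pdivrMr ?sqrtr_gt0 // mulrAC ltr_pdivlMr ?sqrtr_gt0 //.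
rewrite -(@ltr_pXn2r _ 2) // ?nnegrE ?mulr_ge0 ?sqrtr_ge0 ?ltW //.
rewrite !exprMn !sqr_sqrtr ?ltW //.
apply: (@lt_le_trans _ _ (W * (WX * WT))).
  by rewrite expr2 -mulrA ltr_pM2r ?mulr_gt0.
by rewrite expr2 -mulrA ler_pM2l.
Qed.

Lemma beta_exists_unique (R : realType) (d : nat) (sigma : d.-tuple R) :
  (1 <= d)%N -> (forall j, 0 < tnth sigma j) ->
  exists! b, beta_ratio sigma b = 1 / 2.
Proof.
move=> d1 s0.
suff [b bE] : exists b, beta_ratio sigma b = 1 / 2.
  exists b; split => // b' b'E.
  have [bb'|bb'|//] := ltgtP b b'.
    by have := beta_ratio_decr d1 s0 bb'; rewrite bE b'E ltxx.
  by have := beta_ratio_decr d1 s0 bb'; rewrite bE b'E ltxx.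
pose t j := tnth sigma j ^+ 2.
have t0 j : 0 < t j by rewrite exprn_gt0.
pose A b := \sum_j t j * expR (- b / t j).
pose B b := \sum_j tnth sigma j ^+ 4 * expR (- b / t j).
have pos (f : 'I_d -> R) : (forall j, 0 < f j) -> 0 < \sum_j f j.
  move=> f0; rewrite (bigD1 (Ordinal d1)) //= ltr_wpDr //.
  by apply: sumr_ge0 => j _; rewrite ltW.
have A0 b : 0 < A b by apply: pos => j; rewrite mulr_gt0 ?expR_gt0.
have B0 b : 0 < B b.
  by apply: pos => j; rewrite mulr_gt0 ?expR_gt0 ?exprn_gt0.
have rE b : beta_ratio sigma b = A b / Num.sqrt (B b) by [].
(* at 0 the ratio is at least 1 *)
have r0 : 1 <= beta_ratio sigma 0.
  rewrite rE ler_pdivlMr ?sqrtr_gt0 // mul1r -[leRHS](ger0_norm (ltW (A0 0))).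
  rewrite -sqrtr_sqr; apply: ler_wsqrtr; rewrite expr2 /A mulr_suml.
  apply: ler_sum => i _.
  rewrite oppr0 mul0r expR0 !mulr1.
  rewrite (_ : tnth sigma i ^+ 4 = t i * t i); last by rewrite /t; ring.
  rewrite ler_pM2l // (bigD1 i) //= mul0r expR0 mulr1 lerDl.
  by apply: sumr_ge0 => j _; rewrite mulr_ge0 ?expR_ge0 ?ltW.
pose S := \sum_j t j.
have S0 : 0 < S by exact: pos.
have tS i : t i <= S.
  rewrite /S (bigD1 i) //= lerDl; apply: sumr_ge0 => j _; exact/ltW.
have dR : 1 <= d%:R :> R by rewrite ler1n.
pose M : R := S * ln ((2 * d%:R) ^+ 2).
have M0 : 0 <= M.
  apply: mulr_ge0; first exact/ltW.
  by apply: ln_ge0; rewrite -[1](expr1n _ 2) lerXn2r ?nnegrE; lra.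
(* A M ^ 2 <= B M / 4, because each term of A M is at most sqrt (B M) / (2 d) *)
have rM : beta_ratio sigma M <= 1 / 2.
  rewrite rE ler_pdivrMr ?sqrtr_gt0 //.
  apply: (@le_trans _ _ (\sum_(j < d) (Num.sqrt (B M) / (2 * d%:R)))).
    apply: ler_sum => j _; rewrite ler_pdivlMr; last by lra.
    rewrite -[leLHS]ger0_norm; last first.
      apply: mulr_ge0; last by lra.
      by rewrite mulr_ge0 ?expR_ge0 ?(ltW (t0 j)).
    rewrite -sqrtr_sqr; apply: ler_wsqrtr; rewrite /B (bigD1 j) //= ler_wpDr //.
      by apply: sumr_ge0 => i _; rewrite mulr_ge0 ?expR_ge0 ?exprn_ge0 ?ltW.
    rewrite (_ : tnth sigma j ^+ 4 = t j ^+ 2); last by rewrite /t; ring.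
    rewrite (exprMn 2 (t j * _)) (exprMn 2 (t j)) -mulrA ler_pM2l; last first.
      by rewrite exprn_gt0.
    rewrite expr2 -mulrA.
    rewrite ger_pMr ?expR_gt0 //.
    rewrite -[X in _ * X]lnK; last by rewrite posrE exprn_gt0 //; lra.
    rewrite -expRD expR_le1 mulNr addrC subr_le0 ler_pdivlMr // /M mulrC.
    rewrite ler_wpM2r //.
    by apply: ln_ge0; rewrite -[1](expr1n _ 2) lerXn2r ?nnegrE; lra.
  rewrite sumr_const card_ord -mulr_natr.
  by rewrite le_eqVlt; apply/orP; left; apply/eqP; field; lra.
have cont : {within `[0, M], continuous (beta_ratio sigma)}.
  apply: continuous_subspaceT => b.
  have cA (f : 'I_d -> R) :
      {for b, continuous (fun b : R => \sum_j f j * expR (- b / t j))}.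
    elim: (index_enum _) => [|j r IH].
      rewrite (_ : (fun _ => _) = cst 0); first exact: cst_continuous.
      by apply/funext => c; rewrite big_nil.
    rewrite (_ : (fun _ => _) = (fun c => f j * expR (- c / t j)) \+
      (fun c => \sum_(i <- r) f i * expR (- c / t i))); last first.
      by apply/funext => c; rewrite big_cons.
    apply: continuousD => //; apply: cvgMl_tmp.
    apply: (@continuous_comp _ _ _ (fun c : R => - c / t j) expR).
      by apply: cvgMr_tmp; apply: cvgN; exact: cvg_id.
    exact: continuous_expR.
  apply: cvgM; first exact: cA.
  apply: cvgV; first by rewrite gt_eqF // sqrtr_gt0; exact: B0.
  apply: (@continuous_comp _ _ _ B Num.sqrt); first exact: cA.
  exact: sqrt_continuous.
have [|b _ bE] := IVT M0 cont (v := 1 / 2); last by exists b.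
by rewrite ge_min rM orbT /= le_max; apply/orP; left; lra.
Qed.

(* For d >= 1 and positive sigma_j the solution exists and is unique by
   [beta_exists_unique]; the default 0 of [xget] is then never used. *)
Definition beta (R : realType) (d : nat) (sigma : d.-tuple R) : R :=
  xget 0 [set b | beta_ratio sigma b = 1 / 2].

Definition lambda (R : realType) (d : nat) (sigma : d.-tuple R) : R :=
  Num.sqrt (Num.max (beta sigma) 0).

Definition nu (R : realType) (d : nat) (sigma : d.-tuple R) : R :=
  (\sum_(j < d) tnth sigma j ^+ 4 *
     expR (- lambda sigma ^+ 2 / tnth sigma j ^+ 2)) `^ (1 / 4).

(* Main.v *)
Require Import Defs.
From HB Require Import structures.
From mathcomp Require Import all_boot all_order all_algebra.
From mathcomp Require Import all_classical all_reals all_analysis.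
From mathcomp Require Import measurable_realfun ring lra.

(* For the upper bound, [nu^4 = sum_j sigma_j^4 exp (- lambda^2 / sigma_j^2)]
   and [exp (- y) <= 2 / y^2] make the union bound for the maximum at level
   [C (lambda + nu)] at most [64 / C^4].  For the lower bound, the least
   favourable prior puts mass proportional to
   [sigma_j^2 exp (- lambda^2 / sigma_j^2)] on the one-sparse vector [eps e_j]:
   by convexity of [exp] its chi-square distance to the null is at most [4 c^2]
   when [eps <= c lambda].  This suffices for the rate [lambda + nu]: the
   equation defining [beta] always forces [beta > 0] and [nu <= lambda]. *)

Set Implicit Arguments.
Unset Strict Implicit.
Unset Printing Implicit Defensive.

Import Order.TTheory GRing.Theory Num.Theory.
Import numFieldNormedType.Exports.

Local Open Scope classical_set_scope.
Local Open Scope ring_scope.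

(** * Change of measure on the real line *)

Section density.
Import HBNNSimple.

(** Both sides are limits, by monotone convergence, along the increasing simple approximations [h n]
    of [f]. For a simple function the identity is the hypothesis on [nu], applied to each level
    set. *)
Lemma ge0_integral_density d (T : measurableType d) (R : realType)
    (mu nu : {measure set T -> \bar R}) (g : T -> R) (f : T -> \bar R) :
  (forall x, 0 <= g x) -> measurable_fun setT g ->
  (forall A, measurable A -> nu A = \int[mu]_(x in A) (g x)%:E)%E ->
  (forall x, 0 <= f x)%E -> measurable_fun setT f ->
  (\int[nu]_x f x = \int[mu]_x (f x * (g x)%:E))%E.
Proof.
move=> g0 mg nuE f0 mf.
have mgE : measurable_fun setT (EFin \o g) by exact/measurable_EFinP.
pose h := nnsfun_approx measurableT mf.
have hf x : EFin \o h ^~ x @ \oo --> f x by exact: cvg_nnsfun_approx.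
transitivity (limn (fun n => \int[nu]_x (h n x)%:E)%E).
  rewrite -monotone_convergence//.
  - by apply: eq_integral => x _; apply/esym/cvg_lim => //; exact: hf.
  - by move=> n; exact/measurable_EFinP/measurable_funP.
  - by move=> n x _; rewrite lee_fin.
  - by move=> x _ a b ab; rewrite lee_fin; exact/lefP/nd_nnsfun_approx.
transitivity (limn (fun n => \int[mu]_x ((h n x)%:E * (g x)%:E))%E); last first.
  rewrite -monotone_convergence//.
  - apply: eq_integral => x _; apply/cvg_lim => //.
    by apply: cvgeZr => //; exact: hf.
  - by move=> n; apply: emeasurable_funM => //; exact/measurable_EFinP.
  - by move=> n x _; rewrite mule_ge0 ?lee_fin.
  - move=> x _ a b ab; rewrite lee_wpmul2r ?lee_fin//.
    exact/lefP/nd_nnsfun_approx.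
congr (limn _); apply/funext => n; rewrite integralT_nnsfun sintegralE.
have indich r : measurable_fun setT
    (fun x => (r * \1_(h n @^-1` [set r]) x)%:E).
  by apply/measurable_EFinP; exact: measurable_funM.
have hE x : ((h n x)%:E * (g x)%:E = \sum_(r \in range (h n))
    ((r * \1_(h n @^-1` [set r]) x)%:E * (g x)%:E))%E.
  rewrite {1}(fimfunE (h n)) -fsumEFin // ge0_mule_fsuml // => r.
  exact: nnfun_muleindic_ge0.
under [RHS]eq_integral do rewrite hE.
rewrite /= ge0_integral_fsum//; last 2 first.
- by move=> r; apply: emeasurable_funM.
- by move=> r x _; rewrite mule_ge0 ?nnfun_muleindic_ge0 ?lee_fin.
apply: eq_fsbigr => r rh; rewrite nuE// integral_mkcond -ge0_integralZl//.
- apply: eq_integral => x _.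
  by rewrite epatch_indic /= EFinM -muleA [in RHS](muleC (\1__ x)%:E).
- apply/(measurable_restrictT _ _).1 => //; exact: measurable_funTS.
- by move=> x _; apply: erestrict_ge0 => y _; rewrite lee_fin.
- by move: rh; rewrite inE => -[x _ <-]; rewrite lee_fin.
Qed.

End density.

(** The normalising peak depends on [s] alone, so only the exponents differ: expand the square. *)
Lemma normal_pdf_shift (R : realType) (m s x : R) : s != 0 ->
  normal_pdf m s x =
  expR (m * x / s ^+ 2 - m ^+ 2 / (s ^+ 2 *+ 2)) * normal_pdf 0 s x.
Proof.
move=> s0; rewrite !normal_pdfE // /normal_fun mulrCA -expRD.
by congr (_ * expR _); field.
Qed.

Lemma integral_normal_prob_shift (R : realType) (m s : R)
    (f : measurableTypeR R -> \bar R) :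
  s != 0 -> (forall x, 0 <= f x)%E -> measurable_fun setT f ->
  (\int[normal_prob m s]_x f x = \int[normal_prob 0%R s]_x
     (f x * (expR (m * x / s ^+ 2 - m ^+ 2 / (s ^+ 2 *+ 2)))%:E))%E.
Proof.
move=> s0 f0 mf.
have pdf_ge0 a x : 0 <= normal_pdf a s x by exact: normal_pdf_ge0.
have mpdf a : measurable_fun [set: measurableTypeR R] (normal_pdf a s).
  exact: measurable_normal_pdf.
have dens a h := @ge0_integral_density _ (measurableTypeR R) R
  lebesgue_measure (normal_prob a s) (normal_pdf a s) h (pdf_ge0 a) (mpdf a)
  (fun _ _ => erefl).
rewrite !dens //.
- by apply: eq_integral => x _; rewrite (normal_pdf_shift _ _ s0) EFinM muleA.
- by move=> x; rewrite mule_ge0 ?lee_fin ?expR_ge0.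
- apply: emeasurable_funM => //; apply/measurable_EFinP.
  apply: measurableT_comp => //; apply: measurable_funB => //.
  by apply: measurable_funM => //; exact: measurable_funM.
Qed.

(** * Gaussian tails *)

Lemma measurable_abs_ge (R : realType) (m a : R) :
  measurable [set x : R | a <= `|x - m|].
Proof.
rewrite (_ : [set x | _] = (fun x => `|x - m|) @^-1` `[a, +oo[); last first.
  by apply/seteqP; split => x /=; rewrite in_itv /= andbT.
rewrite -[X in measurable X]setTI.
have : measurable_fun setT (fun x : R => `|x - m|).
  by apply: measurableT_comp => //; exact: measurable_funB.
by apply.
Qed.

(* On the tail the density of N(m, s^2) is at most
   [sqrt 2 * exp (- a^2 / (4 s^2))] times the density of N(m, 2 s^2). *)
Lemma normal_prob_tail (R : realType) (m s a : R) : 0 < s -> 0 <= a ->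
  (normal_prob m s [set x | (a <= `|x - m|)%R] <=
   (2 * expR (- (a ^+ 2 / (4 * s ^+ 2))))%:E)%E.
Proof.
move=> s0 a0; set A := [set x | _]; set E := expR _.
pose r := Num.sqrt 2 * s.
have r0 : 0 < r by rewrite mulr_gt0 ?sqrtr_gt0.
have sq2 : (Num.sqrt 2) ^+ 2 = 2 :> R by rewrite sqr_sqrtr.
have r2 : r ^+ 2 = 2 * s ^+ 2 by rewrite exprMn sq2.
have mA : measurable (A : set (measurableTypeR R)) by exact: measurable_abs_ge.
have pdfle x : A x -> normal_pdf m s x <= 2 * E * normal_pdf m r x.
  move=> Ax; rewrite !normal_pdfE ?gt_eqF // /normal_fun.
  have pk : normal_peak s = Num.sqrt 2 * normal_peak r.
    rewrite /normal_peak r2.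
    rewrite (_ : 2 * s ^+ 2 * pi *+ 2 = 2 * (s ^+ 2 * pi *+ 2)); last by ring.
    rewrite sqrtrM // invfM mulrA divff ?mul1r //.
  have pr0 : 0 < normal_peak r by rewrite normal_peak_gt0 ?gt_eqF.
  rewrite pk -!mulrA; apply: ler_pM.
  - by rewrite sqrtr_ge0.
  - by rewrite mulr_ge0 ?expR_ge0 ?ltW.
  (* The ratio [sqrt 2] of the two peaks is rounded up to 2. *)
  - rewrite -[leRHS]ger0_norm // -sqrtr_sqr.
    by apply: ler_wsqrtr; rewrite expr2; lra.
  rewrite mulrCA ler_pM2l // /E -expRD ler_expR r2.
  have s2 : 0 < s ^+ 2 by rewrite exprn_gt0.
  have ax : a ^+ 2 <= (x - m) ^+ 2.
    by rewrite -[leRHS]real_normK ?num_real // lerXn2r ?nnegrE.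
  rewrite -subr_ge0 (_ : _ - _ = ((x - m) ^+ 2 - a ^+ 2) / (4 * s ^+ 2)).
    by rewrite divr_ge0 ?subr_ge0 // mulr_ge0 // ltW.
  by field; rewrite gt_eqF.
rewrite /normal_prob.
apply: (@le_trans _ _
  (\int[lebesgue_measure]_(x in A) ((2 * E)%:E * (normal_pdf m r x)%:E))%E).
  apply: ge0_le_integral => //.
  - by move=> x _; rewrite lee_fin normal_pdf_ge0.
  - by apply/measurable_EFinP/measurable_funTS; exact: measurable_normal_pdf.
  - apply/measurable_EFinP/measurable_funTS/measurable_funM => //.
    exact: measurable_normal_pdf.
rewrite ge0_integralZl //.
- rewrite -[leRHS]mule1 lee_wpmul2l ?lee_fin ?mulr_ge0 ?expR_ge0 //.
  exact: (@probability_le1 _ _ _ (normal_prob m r)).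
- by apply/measurable_EFinP/measurable_funTS; exact: measurable_normal_pdf.
- by move=> x _; rewrite lee_fin normal_pdf_ge0.
- by rewrite lee_fin mulr_ge0 ?expR_ge0.
Qed.

(** * Likelihood ratios of product Gaussians *)

(** The density of N(theta, Sigma) with respect to N(0, Sigma). Being one exponential of a sum, it
    multiplies by adding exponents. *)
Definition likelihood (R : realType) (d : nat) (theta sigma x : d.-tuple R) :
    R :=
  expR (\sum_(j < d) (tnth theta j * tnth x j / tnth sigma j ^+ 2 -
                      tnth theta j ^+ 2 / (tnth sigma j ^+ 2 *+ 2))).

Lemma measurable_likelihood (R : realType) (d : nat)
    (theta sigma : d.-tuple R) :
  measurable_fun setT (likelihood theta sigma).
Proof.
apply: measurableT_comp => //; apply: measurable_sum => j.
apply: measurable_funB => //; apply: measurable_funM => //.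
by apply: measurable_funM => //; exact: measurable_tnth.
Qed.

Lemma likelihood_ge0 (R : realType) (d : nat) (theta sigma x : d.-tuple R) :
  0 <= likelihood theta sigma x.
Proof. exact: expR_ge0. Qed.

Lemma integral_gaussianS (R : realType) (d : nat)
    (theta sigma : d.+1.-tuple R) (f : d.+1.-tuple R -> \bar R) :
  (forall x, 0 <= f x)%E -> measurable_fun setT f ->
  (\int[gaussian theta sigma]_x f x =
   \int[normal_prob (thead theta) (thead sigma)]_x
     \int[gaussian (behead_tuple theta) (behead_tuple sigma)]_y
       f (tuple_cons (x, y)))%E.
Proof.
move=> f0 mf.
have mcons := @measurable_tuple_cons R d.
transitivity (\int[normal_prob (thead theta) (thead sigma)
  \x gaussian (behead_tuple theta) (behead_tuple sigma)]_z
  (f \o @tuple_cons R d) z)%E.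
  exact: ge0_integral_distribution.
rewrite fubini_tonelli1 //; first exact: measurableT_comp.
by move=> z /=.
Qed.

Lemma likelihood_cons (R : realType) (d : nat) (theta sigma : d.+1.-tuple R)
    (x : R) (y : d.-tuple R) :
  likelihood theta sigma (tuple_cons (x, y)) =
  likelihood (behead_tuple theta) (behead_tuple sigma) y *
  expR (thead theta * x / thead sigma ^+ 2 -
        thead theta ^+ 2 / (thead sigma ^+ 2 *+ 2)).
Proof.
rewrite /likelihood big_ord_recl expRD mulrC {1}/tuple_cons tnth0.
congr (expR _ * _).
apply: eq_bigr => j _; rewrite /tuple_cons tnthS.
by rewrite [in LHS](tuple_eta theta) [in LHS](tuple_eta sigma) !tnthS.
Qed.

Lemma measurable_tuple_cons1 (R : realType) (d : nat) (x : measurableTypeR R) :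
  measurable_fun setT (fun y : d.-tuple R => tuple_cons (x, y)).
Proof.
exact: (measurableT_comp (@measurable_tuple_cons R d) (measurable_pair1 x)).
Qed.

(** Induction on [d]: Tonelli splits off the first coordinate, the induction hypothesis changes the
    measure of the inner integral, and the one-dimensional shift that of the outer one. The two
    factors multiply to the full likelihood by [likelihood_cons]. *)
Lemma integral_gaussian_likelihood (R : realType) (d : nat)
    (theta sigma : d.-tuple R) (f : d.-tuple R -> \bar R) :
  (forall j, 0 < tnth sigma j) ->
  (forall x, 0 <= f x)%E -> measurable_fun setT f ->
  (\int[gaussian theta sigma]_x f x =
   \int[gaussian (nseq_tuple d 0%R) sigma]_x
     (f x * (likelihood theta sigma x)%:E))%E.
Proof.
elim: d theta sigma f => [|d IH] theta sigma f s0 f0 mf.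
  rewrite /= !integral_dirac //.
    by rewrite !diracT !mul1e /likelihood big_ord0 expR0 mule1.
  apply: emeasurable_funM => //; apply/measurable_EFinP.
  exact: measurable_likelihood.
have mlik (k : nat) (t s : k.-tuple R) :
    measurable_fun setT (fun x => (likelihood t s x)%:E).
  by apply/measurable_EFinP; exact: measurable_likelihood.
have lik0 (k : nat) (t s x : k.-tuple R) : (0 <= (likelihood t s x)%:E)%E.
  by rewrite lee_fin likelihood_ge0.
pose g x := (f x * (likelihood theta sigma x)%:E)%E.
have g0 x : (0 <= g x)%E by rewrite mule_ge0.
have mg : measurable_fun setT g by apply: emeasurable_funM => //; exact: mlik.
apply: (eq_trans (integral_gaussianS theta sigma f0 mf)); apply: esym.
apply: (eq_trans (integral_gaussianS (nseq_tuple d.+1 0) sigma g0 mg)).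
apply: esym; rewrite /g {g0 mg g}.
set th : d.-tuple R := behead_tuple theta.
set sg : d.-tuple R := behead_tuple sigma.
have -> : behead_tuple (nseq_tuple d.+1 0) = nseq_tuple d 0 :> d.-tuple R.
  exact: val_inj.
have -> : thead (nseq_tuple d.+1 0) = 0 :> R by [].
have s0' j : 0 < tnth sg j.
  by have := s0 (lift ord0 j); rewrite {1}(tuple_eta sigma) tnthS.
have mfx x : measurable_fun setT (fun y : d.-tuple R => f (tuple_cons (x, y))).
  exact: (measurableT_comp mf (measurable_tuple_cons1 x)).
have mfl x : measurable_fun setT
    (fun y => f (tuple_cons (x, y)) * (likelihood th sg y)%:E)%E.
  by apply: emeasurable_funM => //; exact: mlik.
(* The inner integral after the induction hypothesis: centred in all coordinates but the first. *)
pose F (x : measurableTypeR R) := (\int[gaussian (nseq_tuple d 0%R) sg]_y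
  (f (tuple_cons (x, y)) * (likelihood th sg y)%:E))%E.
have F0 x : (0 <= F x)%E.
  by apply: integral_ge0 => y _; rewrite mule_ge0.
have mF : measurable_fun [set: measurableTypeR R] F.
  apply: (@measurable_fun_fubini_tonelli_F _ _ _ _ _
    (gaussian (nseq_tuple d 0) sg)
    (fun z : measurableTypeR R * d.-tuple R =>
      f (tuple_cons z) * (likelihood th sg z.2)%:E)%E).
  - apply: emeasurable_funM.
      exact: (measurableT_comp mf (@measurable_tuple_cons R d)).
    exact: (measurableT_comp (mlik _ _ _) measurable_snd).
  - by move=> z; rewrite mule_ge0.
transitivity (\int[normal_prob (thead theta) (thead sigma)]_x F x)%E.
  by apply: eq_integral => x _; exact: IH.
apply: (eq_trans (integral_normal_prob_shift _ _ F0 mF)).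
  by rewrite gt_eqF // s0.
apply: eq_integral => x _.
apply: (eq_trans (esym (ge0_integralZr _ _ _ _ _))) => //.
  by move=> y _; rewrite mule_ge0.
by apply: eq_integral => y _; rewrite likelihood_cons EFinM muleA.
Qed.

(** * Second moments of likelihood mixtures *)

Lemma integral_cst_probability d (T : measurableType d) (R : realType)
    (P : probability T R) (r : R) : (\int[P]_x r%:E = r%:E)%E.
Proof.
rewrite (integral_cst P measurableT) -[RHS]mule1.
by congr (_ * _)%E; exact: probability_setT.
Qed.

Lemma ge0_integral_wsum d (T : measurableType d) (R : realType)
    (mu : {measure set T -> \bar R}) (n : nat) (c : 'I_n -> R)
    (g : 'I_n -> T -> R) :
  (forall i, 0 <= c i) -> (forall i x, 0 <= g i x) ->
  (forall i, measurable_fun setT (g i)) ->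
  (\int[mu]_x (\sum_i c i * g i x)%:E =
   \sum_i (c i)%:E * \int[mu]_x (g i x)%:E)%E.
Proof.
move=> c0 g0 mg.
under eq_integral => x _ do rewrite -sumEFin.
rewrite ge0_integral_sum //.
- apply: eq_bigr => i _; under eq_integral => x _ do rewrite EFinM.
  rewrite ge0_integralZl //;
    [exact/measurable_EFinP| |by rewrite lee_fin].
  by move=> x _; rewrite lee_fin.
- by move=> i; apply/measurable_EFinP; exact: measurable_funM.
- by move=> i x _; rewrite lee_fin mulr_ge0.
Qed.

Lemma integral_likelihood (R : realType) (d : nat) (theta sigma : d.-tuple R) :
  (forall j, 0 < tnth sigma j) ->
  (\int[gaussian (nseq_tuple d 0%R) sigma]_x
     (likelihood theta sigma x)%:E = 1)%E.
Proof.
move=> s0.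
have := @integral_gaussian_likelihood R d theta sigma (cst 1%E) s0
  (fun _ => @lee01 R) (measurable_cst _).
rewrite integral_cst_probability => ->.
by apply: eq_integral => x _; rewrite mul1e.
Qed.

Lemma integral_indic_likelihood (R : realType) (d : nat)
    (theta sigma : d.-tuple R) (A : set (d.-tuple R)) :
  (forall j, 0 < tnth sigma j) -> measurable A ->
  (\int[gaussian (nseq_tuple d 0%R) sigma]_x
     (\1_A x * likelihood theta sigma x)%:E = gaussian theta sigma A)%E.
Proof.
move=> s0 mA.
have := @integral_gaussian_likelihood R d theta sigma (EFin \o \1_A) s0.
rewrite /= integral_indic // setIT => -> //.
by apply/measurable_EFinP; exact: measurable_indic.
Qed.

(** The exponent is linear in [x] minus a square in the mean, so adding the means leaves only the
    cross term. Since a likelihood integrates to 1, that cross term is the second moment computed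
    next. *)
Lemma likelihood_mul (R : realType) (d : nat) (t u sigma x : d.-tuple R) :
  (forall j, 0 < tnth sigma j) ->
  likelihood t sigma x * likelihood u sigma x =
  expR (\sum_j tnth t j * tnth u j / tnth sigma j ^+ 2) *
  likelihood [tuple tnth t j + tnth u j | j < d] sigma x.
Proof.
move=> s0; rewrite -!expRD -!big_split; congr expR; apply: eq_bigr => j _ /=.
by rewrite tnth_mktuple; field; rewrite gt_eqF.
Qed.

Lemma integral_likelihood_mul (R : realType) (d : nat)
    (t u sigma : d.-tuple R) :
  (forall j, 0 < tnth sigma j) ->
  (\int[gaussian (nseq_tuple d 0%R) sigma]_x
     (likelihood t sigma x * likelihood u sigma x)%:E =
   (expR (\sum_j tnth t j * tnth u j / tnth sigma j ^+ 2))%:E)%E.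
Proof.
move=> s0.
under eq_integral => x _ do rewrite likelihood_mul // EFinM.
rewrite ge0_integralZl //; first by rewrite integral_likelihood // mule1.
- by apply/measurable_EFinP; exact: measurable_likelihood.
- by move=> x _; rewrite lee_fin likelihood_ge0.
Qed.

(* Ingster's second-moment bound: the total variation distance to the mixture
   is at most the chi-square distance, here through
   [1 - L <= c / 2 + (1 - L)^2 / (2 c)] for the mixture likelihood [L]. *)
Lemma gaussian_mixture_le (R : realType) (d n : nat) (sigma : d.-tuple R)
    (p : 'I_n -> R) (theta : 'I_n -> d.-tuple R) (c : R)
    (A : set (d.-tuple R)) :
  (forall j, 0 < tnth sigma j) -> (forall i, 0 <= p i) -> \sum_i p i = 1 ->
  0 < c ->
  \sum_i \sum_k p i * p k * expR (\sum_j
    tnth (theta i) j * tnth (theta k) j / tnth sigma j ^+ 2) <= 1 + c ^+ 2 ->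
  measurable A ->
  (gaussian (nseq_tuple d 0%R) sigma A <=
   \sum_i (p i)%:E * gaussian (theta i) sigma A + c%:E)%E.
Proof.
move=> s0 p0 p1 c0 chi mA; set P := gaussian (nseq_tuple d 0) sigma.
pose L x := \sum_i p i * likelihood (theta i) sigma x.
have lik0 i x : 0 <= likelihood (theta i) sigma x by exact: likelihood_ge0.
have mlik i : measurable_fun setT (likelihood (theta i) sigma).
  exact: measurable_likelihood.
have L0 x : 0 <= L x by apply: sumr_ge0 => i _; rewrite mulr_ge0.
have mL : measurable_fun setT L.
  by apply: measurable_sum => i; exact: measurable_funM.
have mindic : measurable_fun setT (\1_A : d.-tuple R -> R).
  exact: measurable_indic.
have intL : (\int[P]_x (L x)%:E = 1)%E.
  rewrite ge0_integral_wsum //.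
  under eq_bigr => i _ do rewrite integral_likelihood // mule1.
  by rewrite sumEFin p1.
have intLA : (\int[P]_x (\1_A x * L x)%:E =
    \sum_i (p i)%:E * gaussian (theta i) sigma A)%E.
  under eq_integral => x _ do rewrite /L mulr_sumr
    (eq_bigr _ (fun i _ => mulrCA _ _ _)).
  rewrite ge0_integral_wsum //.
  - by apply: eq_bigr => i _; rewrite integral_indic_likelihood.
  - by move=> i x; rewrite mulr_ge0.
  - by move=> i; apply: measurable_funM => //; exact: mlik.
have intL2 : (\int[P]_x (L x ^+ 2)%:E <= (1 + c ^+ 2)%:E)%E.
  have -> : (\int[P]_x (L x ^+ 2)%:E = \int[P]_x (\sum_i p i *
      (\sum_k p k *
        (likelihood (theta i) sigma x * likelihood (theta k) sigma x)))%:E)%E.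
    apply: eq_integral => x _; congr EFin; rewrite expr2 {1}/L mulr_suml.
    apply: eq_bigr => i _; rewrite -mulrA /L mulr_sumr; congr (_ * _).
    by apply: eq_bigr => k _; rewrite mulrCA.
  have mm i k : measurable_fun setT (fun x =>
      likelihood (theta i) sigma x * likelihood (theta k) sigma x).
    exact: measurable_funM.
  rewrite ge0_integral_wsum //; last 2 first.
  - by move=> i x; apply: sumr_ge0 => k _; rewrite !mulr_ge0.
  - by move=> i; apply: measurable_sum => k; exact: measurable_funM.
  under eq_bigr => i _.
    rewrite ge0_integral_wsum //; last by move=> k x; rewrite mulr_ge0.
    under eq_bigr => k _ do rewrite integral_likelihood_mul // -EFinM.
    rewrite sumEFin -EFinM mulr_sumr (eq_bigr _ (fun k _ => mulrA _ _ _)).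
    over.
  by rewrite sumEFin lee_fin.
have intvar : (\int[P]_x ((1 - L x) ^+ 2)%:E <= (c ^+ 2)%:E)%E.
  have mv : measurable_fun setT (fun x => (1 - L x) ^+ 2).
    by apply: measurable_funX; exact: measurable_funB.
  (* Adding 2, which is the integral of [2 * L], turns [(1 - L)^2] into [1 + L^2], so every
     integrand stays nonnegative and no integral is subtracted. *)
  rewrite -(@leeD2rE _ 2%:E) // -EFinD.
  have -> : (2%:E = \int[P]_x (2 * L x)%:E)%E.
    under eq_integral => x _ do rewrite EFinM.
    rewrite ge0_integralZl ?intL ?mule1 //; first exact/measurable_EFinP.
    by move=> x _; rewrite lee_fin.
  rewrite -ge0_integralD //; first last.
  - by apply/measurable_EFinP; exact: measurable_funM.
  - by move=> x _; rewrite lee_fin mulr_ge0.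
  - exact/measurable_EFinP.
  - by move=> x _; rewrite lee_fin sqr_ge0.
  have -> : (\int[P]_x (((1 - L x) ^+ 2)%:E + (2 * L x)%:E) =
      \int[P]_x (1%:E + (L x ^+ 2)%:E))%E.
    by apply: eq_integral => x _; rewrite -!EFinD; congr EFin; ring.
  rewrite ge0_integralD //; first last.
  - by apply/measurable_EFinP; exact: measurable_funX.
  - by move=> x _; rewrite lee_fin sqr_ge0.
  rewrite integral_cst_probability.
  rewrite (_ : c ^+ 2 + 2 = 1 + (1 + c ^+ 2)); last by ring.
  by rewrite EFinD leeD2lE.
have -> : P A = (\int[P]_x (\1_A x)%:E)%E by rewrite integral_indic // setIT.
have c20 : 0 <= (2 * c)^-1 by rewrite invr_ge0 mulr_ge0 // ltW.
pose K x := c / 2 + (2 * c)^-1 * (1 - L x) ^+ 2.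
have K0 x : 0 <= K x.
  by apply: addr_ge0; [rewrite divr_ge0 // ltW|rewrite mulr_ge0 ?sqr_ge0].
have mK : measurable_fun setT K.
  apply: measurable_funD => //; apply: measurable_funM => //.
  by apply: measurable_funX; exact: measurable_funB.
(* Pointwise: on [A] this is [1 - L <= K], whose defect is a square over [2 * c]; off [A] it is
   [0 <= K]. *)
apply: (@le_trans _ _ (\int[P]_x ((\1_A x * L x)%:E + (K x)%:E))%E).
  apply: ge0_le_integral => //.
  - exact/measurable_EFinP.
  - apply: emeasurable_funD; apply/measurable_EFinP => //.
    exact: measurable_funM.
  move=> x _; rewrite -EFinD lee_fin indicE.
  case: (x \in A); rewrite ?mul0r ?add0r ?K0 // mul1r /K -subr_ge0 mulr1n.
  rewrite (_ : _ - _ = (1 - L x - c) ^+ 2 / (2 * c)).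
    by rewrite divr_ge0 ?sqr_ge0 // mulr_ge0 // ltW.
  by field; rewrite gt_eqF.
rewrite ge0_integralD //; first last.
- exact/measurable_EFinP.
- by move=> x _; rewrite lee_fin.
- by apply/measurable_EFinP; exact: measurable_funM.
- by move=> x _; rewrite lee_fin mulr_ge0.
rewrite intLA leeD2l //.
under eq_integral => x _ do rewrite /K EFinD.
rewrite ge0_integralD //; first last.
- apply/measurable_EFinP; apply: measurable_funM => //.
  by apply: measurable_funX; exact: measurable_funB.
- by move=> x _; rewrite lee_fin mulr_ge0 ?sqr_ge0.
- by move=> x _; rewrite lee_fin divr_ge0 // ltW.
rewrite integral_cst_probability; under eq_integral => x _ do rewrite EFinM.
rewrite ge0_integralZl //; first last.
- by move=> x _; rewrite lee_fin sqr_ge0.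
- by apply/measurable_EFinP; apply: measurable_funX; exact: measurable_funB.
apply: (@le_trans _ _ ((c / 2)%:E + (2 * c)^-1%:E * (c ^+ 2)%:E)%E).
  by rewrite leeD2l // lee_wpmul2l // lee_fin.
rewrite -EFinM -EFinD lee_fin le_eqVlt; apply/orP; left; apply/eqP.
by field; rewrite gt_eqF.
Qed.

(** * The parameters [beta], [lambda] and [nu] *)

Lemma sumr_gt0 (R : realType) (d : nat) (f : 'I_d -> R) :
  (0 < d)%N -> (forall j, 0 < f j) -> 0 < \sum_j f j.
Proof.
move=> d0 f0; rewrite (bigD1 (Ordinal d0)) //= ltr_wpDr //.
by apply: sumr_ge0 => j _; rewrite ltW.
Qed.

(** At 0 the ratio is the l1 norm over the l2 norm of the vector of variances. *)
Lemma beta_ratio0_ge1 (R : realType) (d : nat) (sigma : d.-tuple R) :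
  (0 < d)%N -> (forall j, 0 < tnth sigma j) -> 1 <= beta_ratio sigma 0.
Proof.
move=> d0 s0; rewrite /beta_ratio.
under eq_bigr => j _ do rewrite oppr0 mul0r expR0 mulr1.
under [X in Num.sqrt X]eq_bigr => j _ do rewrite oppr0 mul0r expR0 mulr1.
rewrite ler_pdivlMr ?mul1r; last first.
  by rewrite sqrtr_gt0; apply: sumr_gt0 => // j; rewrite exprn_gt0.
have sum0 : 0 <= \sum_j tnth sigma j ^+ 2.
  by apply: sumr_ge0 => j _; rewrite sqr_ge0.
rewrite -[leRHS]ger0_norm // -sqrtr_sqr; apply: ler_wsqrtr.
rewrite expr2 mulr_suml; apply: ler_sum => j _.
rewrite (exprD _ 2 2).
rewrite ler_wpM2l ?sqr_ge0 // (bigD1 j) //= lerDl.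
by apply: sumr_ge0 => i _; rewrite sqr_ge0.
Qed.

Section parameters.
Variables (R : realType) (d : nat) (sigma : d.-tuple R).
Hypotheses (d0 : (0 < d)%N) (s0 : forall j, 0 < tnth sigma j).

Lemma beta_ratio_beta : beta_ratio sigma (beta sigma) = 1 / 2.
Proof.
have [b [bE _]] := beta_exists_unique d0 s0.
exact: (xgetPex 0
  (P := [set b | beta_ratio sigma b = 1 / 2]) (ex_intro _ b bE)).
Qed.

(** The ratio decreases and is at least 1 at 0, so it takes the value 1/2 only to the right of 0. *)
Lemma beta_gt0 : 0 < beta sigma.
Proof.
rewrite ltNge; apply/negP => b0.
have r0 := beta_ratio0_ge1 d0 s0.
suff : 1 <= beta_ratio sigma (beta sigma) by rewrite beta_ratio_beta; lra.
move: b0; rewrite le_eqVlt => /orP[/eqP -> //|b0].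
exact/(le_trans r0)/ltW/beta_ratio_decr.
Qed.

Lemma lambda_sqr : lambda sigma ^+ 2 = beta sigma.
Proof. by rewrite /lambda max_l ?sqr_sqrtr // ltW // beta_gt0. Qed.

Lemma lambda_gt0 : 0 < lambda sigma.
Proof. by rewrite sqrtr_gt0 lt_max beta_gt0. Qed.

Lemma nu_pow4 : nu sigma ^+ 4 =
  \sum_j tnth sigma j ^+ 4 * expR (- lambda sigma ^+ 2 / tnth sigma j ^+ 2).
Proof.
rewrite /nu -powR_mulrn ?powR_ge0 // -powRrM.
rewrite (_ : 1 / 4 * 4%:R = 1); last by field.
rewrite powRr1 //; apply: sumr_ge0 => j _.
by rewrite mulr_ge0 ?expR_ge0 ?exprn_ge0 // ltW.
Qed.

Lemma nu_gt0 : 0 < nu sigma.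
Proof.
rewrite powR_gt0 //; apply: sumr_gt0 => // j.
by rewrite mulr_gt0 ?expR_gt0 ?exprn_gt0.
Qed.

(** This is the equation defining [beta]: with [lambda^2 = beta], its denominator is
    [sqrt (nu^4) = nu^2]. *)
Lemma sum_sqr_expR_lambda :
  \sum_j tnth sigma j ^+ 2 * expR (- lambda sigma ^+ 2 / tnth sigma j ^+ 2) =
  nu sigma ^+ 2 / 2.
Proof.
have := beta_ratio_beta; rewrite /beta_ratio -lambda_sqr -nu_pow4.
rewrite (_ : nu sigma ^+ 4 = (nu sigma ^+ 2) ^+ 2); last by ring.
rewrite sqrtr_sqr ger0_norm ?sqr_ge0 //.
have nu2 : nu sigma ^+ 2 != 0 by rewrite gt_eqF // exprn_gt0 // nu_gt0.
by move/(canRL (divfK nu2)) => ->; field.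
Qed.

(* If [s] is the largest standard deviation, then [nu^4 <= s^2 * nu^2 / 2], and
   the term of [s] in [nu^2 / 2] gives [exp (- lambda^2 / s^2) <= 1 / 4]. *)
Lemma nu_le_lambda (i : 'I_d) :
  (forall j, tnth sigma j <= tnth sigma i) -> nu sigma <= lambda sigma.
Proof.
move=> imax; set s := tnth sigma i in imax.
have nu2 : 0 < nu sigma ^+ 2 by rewrite exprn_gt0 ?nu_gt0.
have si0 : 0 < s by exact: s0.
have s2 : 0 < s ^+ 2 by rewrite exprn_gt0.
have nu2s : nu sigma ^+ 2 <= s ^+ 2 / 2.
  rewrite -(ler_pM2r nu2) -exprD nu_pow4.
  rewrite (_ : s ^+ 2 / 2 * _ = s ^+ 2 * (nu sigma ^+ 2 / 2)); last by ring.
  rewrite -sum_sqr_expR_lambda mulr_sumr; apply: ler_sum => j _.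
  rewrite (exprD _ 2 2).
  rewrite -mulrA ler_wpM2r ?(mulr_ge0 (sqr_ge0 _) (expR_ge0 _)) //.
  by rewrite ler_pXn2r ?imax ?nnegrE ?ltW.
have es : expR (- lambda sigma ^+ 2 / s ^+ 2) <= 1 / 4.
  rewrite -(ler_pM2l s2); apply: (@le_trans _ _ (nu sigma ^+ 2 / 2));
    last by lra.
  rewrite -sum_sqr_expR_lambda (bigD1 i) //= lerDl.
  by apply: sumr_ge0 => j _; rewrite mulr_ge0 ?expR_ge0 ?sqr_ge0.
(* From [1 - y <= exp (- y) <= 1 / 4] comes [y >= 3 / 4], hence
   [lambda^2 >= 3 s^2 / 4 >= s^2 / 2 >= nu^2]. *)
have := le_trans (expR_ge1Dx _) es; rewrite mulNr => lam.
have : 3 / 4 <= lambda sigma ^+ 2 / s ^+ 2 by lra.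
rewrite ler_pdivlMr // => lams.
rewrite -(@ler_pXn2r _ 2) ?nnegrE ?ltW ?nu_gt0 ?lambda_gt0 //.
lra.
Qed.

End parameters.

(** * Exponential inequalities, marginals and the union bound *)

(** Convexity of [exp] between 0 and [x]: the tangent at [c * x] is evaluated at [x] and at 0, and
    the two bounds are averaged with weights [c] and [1 - c]. *)
Lemma expR_subr1_le (R : realType) (c x : R) : 0 <= c <= 1 ->
  expR (c * x) - 1 <= c * (expR x - 1).
Proof.
move=> /andP[c0 c1]; have e0 := expR_gt0 (c * x).
have e1 : expR (c * x) * (1 + (x - c * x)) <= expR x.
  rewrite -[leRHS](_ : expR (c * x) * expR (x - c * x) = _).
    by rewrite ler_pM2l // expR_ge1Dx.
  by rewrite -expRD; congr expR; ring.
have e2 : expR (c * x) * (1 - c * x) <= 1.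
  rewrite -[leRHS](_ : expR (c * x) * expR (- (c * x)) = _).
    by rewrite ler_pM2l // expR_ge1Dx.
  by rewrite -expRD subrr expR0.
have := ler_wpM2l c0 e1; have := ler_wpM2l (_ : 0 <= 1 - c) e2.
rewrite subr_ge0 => /(_ c1); nra.
Qed.

Lemma expRN_le (R : realType) (y : R) : 0 < y -> expR (- y) <= 2 / y ^+ 2.
Proof.
move=> y0; rewrite expRN -[leRHS]invf_div.
rewrite lef_pV2 ?posrE ?expR_gt0 ?divr_gt0 ?exprn_gt0 //.
by have := expR_ge1Dxn 1 (ltW y0); rewrite (_ : 2`!%:R = 2%:R :> R) //; lra.
Qed.

(** The event is a box whose other sides are the whole line, each of mass 1. *)
Lemma gaussian_marginal (R : realType) (d : nat) (theta sigma : d.-tuple R)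
    (j : 'I_d) (A : set R) : measurable A ->
  gaussian theta sigma [set x | A (tnth x j)] =
  normal_prob (tnth theta j) (tnth sigma j) A.
Proof.
move=> mA; pose B i := if i == j then A else [set: R].
rewrite (_ : [set x | _] = [set x | forall i, B i (tnth x i)]); last first.
  apply/seteqP; split => x /= H; last by have := H j; rewrite /B eqxx.
  by move=> i; rewrite /B; case: eqP => // ->.
rewrite gaussian_box; last by move=> i; rewrite /B; case: eqP.
rewrite (bigD1 j) //= {1}/B eqxx big1 ?mule1 // => i /negbTE ij.
rewrite /B ij.
exact: (probability_setT (normal_prob (tnth theta i) (tnth sigma i))).
Qed.

Lemma measurable_tnth_abs_ge (R : realType) (d : nat) (j : 'I_d) (m a : R) :
  measurable [set x : d.-tuple R | a <= `|tnth x j - m|].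
Proof.
rewrite -[X in measurable X]setTI.
have mj : measurable_fun setT (fun x : d.-tuple R => tnth x j).
  exact: measurable_tnth.
exact: (mj measurableT _ (measurable_abs_ge m a)).
Qed.

Lemma measure_bigsetU_le d (T : measurableType d) (R : realType)
    (mu : {measure set T -> \bar R}) (I : Type) (r : seq I) (A : I -> set T) :
  (forall i, measurable (A i)) ->
  (mu (\big[setU/set0]_(i <- r) A i) <= \sum_(i <- r) mu (A i))%E.
Proof.
move=> mA; elim: r => [|i r IH]; first by rewrite !big_nil measure0.
rewrite !big_cons.
apply: (@le_trans _ _ (mu (A i) + mu (\big[setU/set0]_(j <- r) A j))%E).
  by apply: measureU2 => //; exact: bigsetU_measurable.
by rewrite leeD2l.
Qed.

Lemma measurable_test_eq (R : realType) (d : nat) (psi : test R d) (b : bool) :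
  measurable [set x | psi x = b].
Proof.
rewrite -[X in measurable X]setTI.
by apply: (@measurable_funPT _ _ _ _ psi measurableT [set b]).
Qed.

(** * Upper bound: both errors of the maximum test *)

Section upper_bound.
Variables (R : realType) (d : nat) (sigma : d.-tuple R).
Hypotheses (d0 : (0 < d)%N) (s0 : forall j, 0 < tnth sigma j).

(** Expanding the square, the [lambda] part yields the weight [exp (- lambda^2 / sigma_j^2)], and
    the [nu] part, through [expRN_le], a factor of order [sigma_j^4 / (C * nu)^4]. Summed over [j],
    these products rebuild [nu^4], which cancels. *)
Lemma sum_tail_le (C : R) : 2 <= C ->
  \sum_j 2 * expR (- ((C * (lambda sigma + nu sigma)) ^+ 2 /
                      (4 * tnth sigma j ^+ 2))) <= 64 / C ^+ 4.
Proof.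
move=> C2; have C0 : 0 < C by lra.
have l0 := lambda_gt0 d0 s0; have n0 := nu_gt0 d0 s0.
set l := lambda sigma in l0 *; set n := nu sigma in n0 *.
have term j : 2 * expR (- ((C * (l + n)) ^+ 2 / (4 * tnth sigma j ^+ 2))) <=
    64 / (C ^+ 4 * n ^+ 4) *
    (tnth sigma j ^+ 4 * expR (- l ^+ 2 / tnth sigma j ^+ 2)).
  set s := tnth sigma j; have sj0 : 0 < s by exact: s0.
  have y0 : 0 < C ^+ 2 * n ^+ 2 / (4 * s ^+ 2).
    by rewrite divr_gt0 ?mulr_gt0 ?exprn_gt0.
  (* [C >= 2] makes [C^2 / 4] at least 1 in front of [l^2]; the cross term is dropped. *)
  have split_exp : - ((C * (l + n)) ^+ 2 / (4 * s ^+ 2)) <=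
      - l ^+ 2 / s ^+ 2 + - (C ^+ 2 * n ^+ 2 / (4 * s ^+ 2)).
    rewrite -subr_ge0 (_ : _ - _ =
      ((C ^+ 2 - 4) * l ^+ 2 + C ^+ 2 * (2 * l * n)) / (4 * s ^+ 2)).
      have C24 : 0 <= C ^+ 2 - 4 by nra.
      apply: divr_ge0; last by rewrite mulr_ge0 ?sqr_ge0.
      by rewrite addr_ge0 ?mulr_ge0 ?sqr_ge0 // ltW.
    by field; rewrite gt_eqF.
  have := expRN_le y0; set E1 := expR (- (C ^+ 2 * _ / _)) => E1le.
  apply: (@le_trans _ _ (2 * (expR (- l ^+ 2 / s ^+ 2) * E1))).
    by rewrite ler_pM2l // -expRD ler_expR.
  apply: (@le_trans _ _ (2 * (expR (- l ^+ 2 / s ^+ 2) *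
      (2 / (C ^+ 2 * n ^+ 2 / (4 * s ^+ 2)) ^+ 2)))).
    by rewrite ler_pM2l // ler_pM2l ?expR_gt0.
  rewrite le_eqVlt; apply/orP; left; apply/eqP.
  by field; rewrite !gt_eqF.
apply: le_trans (ler_sum _ (fun j _ => term j)) _.
rewrite -mulr_sumr -nu_pow4 // -/n le_eqVlt; apply/orP; left; apply/eqP.
by field; rewrite !gt_eqF.
Qed.

Lemma max_test_type1 (t : R) : 0 <= t ->
  (gaussian (nseq_tuple d 0%R) sigma [set x | max_test d t x = true] <=
   (\sum_j 2 * expR (- (t ^+ 2 / (4 * tnth sigma j ^+ 2))))%:E)%E.
Proof.
move=> t0; set P := gaussian _ _.
pose A j := [set x : d.-tuple R | t <= `|tnth x j - 0|].
have mA j : measurable (A j) by exact: measurable_tnth_abs_ge.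
apply: (@le_trans _ _ (P (\big[setU/set0]_j A j))).
  apply: le_measure; rewrite ?inE.
  - exact: measurable_test_eq.
  - exact: bigsetU_measurable.
  move=> x /=; rewrite /max_test /max_test_fun /linf => tx.
  rewrite -bigcup_seq /=; apply: contrapT => nA.
  move: tx; rewrite ltNge => /negP; apply; apply: bigmax_le => // j _.
  rewrite leNgt; apply/negP => tj; apply: nA; exists j => /=.
    by rewrite mem_index_enum.
  by rewrite /A /= subr0 ltW.
apply: le_trans (measure_bigsetU_le _ _ mA) _.
rewrite -sumEFin; apply: lee_sum => j _.
have := gaussian_marginal (nseq_tuple d 0) sigma j (measurable_abs_ge 0 t).
by rewrite tnth_nseq => PA; rewrite [leLHS]PA; exact: normal_prob_tail.
Qed.

(** Acceptance forces [|x_j| <= t] at a coordinate with [|theta_j| >= 2 * t], so [x_j] deviates from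
    its mean by at least [t]. *)
Lemma max_test_type2 (theta : d.-tuple R) (t : R) : 0 < t ->
  2 * t <= linf theta ->
  (gaussian theta sigma [set x | max_test d t x = false] <=
   (\sum_j 2 * expR (- (t ^+ 2 / (4 * tnth sigma j ^+ 2))))%:E)%E.
Proof.
move=> t0 tth.
(* As [t > 0], the value of [linf] cannot come from the default 0 of the maximum. *)
have [j tj] : exists j, 2 * t <= `|tnth theta j|.
  apply: contrapT => nj; move: tth; rewrite leNgt => /negP; apply.
  apply: bigmax_lt => [|j _]; first by rewrite mulr_gt0.
  by rewrite ltNge; apply/negP => tj; apply: nj; exists j.
apply: (@le_trans _ _ (gaussian theta sigma
    [set x | t <= `|tnth x j - tnth theta j|])).
  apply: le_measure; rewrite ?inE.
  - exact: measurable_test_eq.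
  - exact: measurable_tnth_abs_ge.
  move=> x /= /negbT; rewrite -leNgt => xt.
  have xj : `|tnth x j| <= t by apply: le_trans xt; exact: le_bigmax.
  have := ler_distD (tnth x j) (tnth theta j) 0.
  rewrite !subr0 (distrC (tnth theta j)); lra.
rewrite (@gaussian_marginal _ _ _ _ j [set y | t <= `|y - tnth theta j|]);
  last exact: measurable_abs_ge.
apply: le_trans (normal_prob_tail _ (s0 j) (ltW t0)) _.
(* One tail term is enlarged to the whole sum, so both errors share one bound. *)
rewrite lee_fin [leRHS](bigD1 j) //= lerDl; apply: sumr_ge0 => i _.
by rewrite mulr_ge0 ?expR_ge0.
Qed.

End upper_bound.

(** * Lower bound: a prior on one-sparse means *)

Section lower_bound.
Variables (R : realType) (d : nat) (sigma : d.-tuple R).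
Hypotheses (d0 : (0 < d)%N) (s0 : forall j, 0 < tnth sigma j).

Definition spike (eps : R) (j : 'I_d) : d.-tuple R :=
  [tuple if i == j then eps else 0 | i < d].

Lemma spike_Theta (eps : R) (s : nat) (j : 'I_d) : 0 < eps -> (1 <= s)%N ->
  Theta eps s (spike eps j).
Proof.
move=> e0 s1; split.
  apply: le_trans (le_bigmax _ _ j).
  by rewrite tnth_mktuple eqxx ger0_norm // ltW.
apply: leq_trans s1; rewrite /l0 -(card1 j); apply: subset_leq_card.
apply/fintype.subsetP => i; rewrite !inE tnth_mktuple.
by case: (i == j) => //; rewrite eqxx.
Qed.

(** The normalisation [nu^2 / 2] is the total mass, by [sum_sqr_expR_lambda]. The squared weight
    times [exp (lambda^2 / sigma_j^2)] is [4 / nu^4] times the [j]-th term of [nu^4]. *)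
Definition spike_prior (j : 'I_d) : R :=
  tnth sigma j ^+ 2 * expR (- lambda sigma ^+ 2 / tnth sigma j ^+ 2) /
  (nu sigma ^+ 2 / 2).

Lemma spike_prior_ge0 j : 0 <= spike_prior j.
Proof.
by rewrite divr_ge0 ?(mulr_ge0 (sqr_ge0 _) (expR_ge0 _)) ?divr_ge0 ?sqr_ge0.
Qed.

Lemma sum_spike_prior : \sum_j spike_prior j = 1.
Proof.
rewrite -mulr_suml sum_sqr_expR_lambda // divff //.
by rewrite gt_eqF // divr_gt0 // exprn_gt0 // nu_gt0.
Qed.

Lemma spike_chi_square (eps c : R) : 0 < eps -> 0 < c -> c <= 1 ->
  eps <= c * lambda sigma ->
  \sum_i \sum_k spike_prior i * spike_prior k * expR (\sum_j
    tnth (spike eps i) j * tnth (spike eps k) j / tnth sigma j ^+ 2) <=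
  1 + (2 * c) ^+ 2.
Proof.
move=> e0 c0 c1 el.
have dot i k : \sum_j tnth (spike eps i) j * tnth (spike eps k) j /
    tnth sigma j ^+ 2 = if k == i then eps ^+ 2 / tnth sigma i ^+ 2 else 0.
  rewrite (bigD1 i) //= big1 ?addr0; last first.
    by move=> j /negbTE ji; rewrite tnth_mktuple ji !mul0r.
  rewrite !tnth_mktuple eqxx eq_sym; case: (k == i); first by rewrite expr2.
  by rewrite mulr0 mul0r.
(* Distinct spikes are orthogonal, so off-diagonal pairs contribute their prior mass only and the
   diagonal carries the excess [D]. *)
pose D i := expR (eps ^+ 2 / tnth sigma i ^+ 2) - 1.
have -> : \sum_i \sum_k spike_prior i * spike_prior k * expR (\sum_j
    tnth (spike eps i) j * tnth (spike eps k) j / tnth sigma j ^+ 2) =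
    1 + \sum_i spike_prior i ^+ 2 * D i.
  rewrite -{1}sum_spike_prior -big_split; apply: eq_bigr => i _ /=.
  under eq_bigr => k _ do rewrite dot.
  rewrite (bigD1 i) //= eqxx.
  under eq_bigr => k /negbTE ki do rewrite ki expR0 mulr1.
  have := sum_spike_prior; rewrite -mulr_sumr (bigD1 i) //=.
  by move=> /(canRL (addKr _)) ->; rewrite /D; ring.
rewrite lerD2l.
have n0 : 0 < nu sigma by exact: nu_gt0.
have term i : spike_prior i ^+ 2 * D i <= (2 * c) ^+ 2 / nu sigma ^+ 4 *
    (tnth sigma i ^+ 4 * expR (- lambda sigma ^+ 2 / tnth sigma i ^+ 2)).
  set s := tnth sigma i; have si0 : 0 < s by exact: s0.
  set x := lambda sigma ^+ 2 / s ^+ 2.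
  (* [eps^2 / s^2] is at most [c^2 * x]; convexity then pulls [c^2] out of the exponential. *)
  have Dle : D i <= c ^+ 2 * expR x.
    have c21 : 0 <= c ^+ 2 <= 1 by rewrite sqr_ge0 expr_le1 // ltW.
    apply: le_trans (_ : c ^+ 2 * (expR x - 1) <= _); last first.
      by rewrite ler_wpM2l ?sqr_ge0 // gerBl.
    apply: le_trans (expR_subr1_le x c21); rewrite lerD2r ler_expR /x mulrA.
    rewrite ler_pM2r ?invr_gt0 ?exprn_gt0 // -exprMn.
    rewrite ler_pXn2r ?nnegrE ?(ltW e0) //.
    exact: le_trans (ltW e0) el.
  apply: (@le_trans _ _ (spike_prior i ^+ 2 * (c ^+ 2 * expR x))).
    by rewrite ler_wpM2l ?sqr_ge0.
  rewrite le_eqVlt; apply/orP; left; apply/eqP.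
  rewrite /spike_prior -/s mulNr -/x expRN.
  by field; rewrite !gt_eqF ?expR_gt0.
apply: le_trans (ler_sum _ (fun i _ => term i)) _.
rewrite -mulr_sumr -nu_pow4 // divfK // gt_eqF // exprn_gt0 //.
Qed.

(** The worst type II error dominates its prior average. The mixture bound, taken at [2 * c],
    compares that average with the null probability of acceptance, which is 1 minus the type I
    error. *)
Lemma risk_ge (psi : test R d) (eps c : R) (s : nat) : 0 < eps -> 0 < c ->
  c <= 1 -> (1 <= s)%N -> eps <= c * lambda sigma ->
  ((1 - 2 * c)%:E <= risk sigma psi eps s)%E.
Proof.
move=> e0 c0 c1 s1 el.
set A := [set x | psi x = false].
have mA : measurable A by exact: measurable_test_eq.
have mix := gaussian_mixture_le s0 spike_prior_ge0 sum_spike_prior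
  (mulr_gt0 (ltr0Sn R 1) c0) (spike_chi_square e0 c0 c1 el) mA.
rewrite /risk; set S := ereal_sup _.
have leS j : (gaussian (spike eps j) sigma A <= S)%E.
  by apply: ereal_sup_ubound; exists (spike eps j) => //; exact: spike_Theta.
have mixS : (\sum_i (spike_prior i)%:E * gaussian (spike eps i) sigma A <= S)%E.
  apply: (@le_trans _ _ (\sum_i (spike_prior i)%:E * S)%E).
    by apply: lee_sum => i _; rewrite lee_wpmul2l // lee_fin spike_prior_ge0.
  rewrite -ge0_sume_distrl; last by move=> i _; rewrite lee_fin spike_prior_ge0.
  by rewrite sumEFin sum_spike_prior mul1e.
have -> : [set x | psi x = true] = ~` A.
  by apply/seteqP; split => x /=; rewrite /A /=; case: (psi x) => // /(_ erefl).
rewrite probability_setC //.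
(* Finiteness of the null probability allows it to be moved across the inequality; the supremum [S]
   is then treated by cases. *)
have Pfin : gaussian (nseq_tuple d 0) sigma A \is a fin_num.
  exact: fin_num_measure.
move: mix; set p := gaussian (nseq_tuple d 0) sigma A in Pfin *.
rewrite -(fineK Pfin) => mix.
have : ((fine p)%:E <= S + (2 * c)%:E)%E.
  by apply: le_trans mix _; rewrite leeD2r.
case: S {leS mixS} => [r| |] //=.
- by rewrite -!EFinD !lee_fin; lra.
- by move=> _; rewrite leey.
Qed.

End lower_bound.

(** * Choice of the constants and conclusion *)

Theorem theorem3 (R : realType) (eta : R) (eta_gt0 : 0 < eta)
    (eta_lt1 : eta < 1) :
  exists c C1 C C' : R, [/\ 0 < c, 0 < C1, 0 < C, 0 < C' &
    forall (d : nat) (sigma : d.-tuple R),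
      (1 <= d)%N ->
      (forall j : 'I_d, 0 < tnth sigma j) ->
      (forall i j : 'I_d, (i <= j)%N -> tnth sigma j <= tnth sigma i) ->
      (forall s : nat, (1 <= s <= d)%N ->
         ((c * (lambda sigma + nu sigma))%:E <= eps_star sigma eta s)%E /\
         (eps_star sigma eta s <= (C1 * (lambda sigma + nu sigma))%:E)%E) /\
      (let psi := max_test d (C * (lambda sigma + nu sigma)) in
       (gaussian (nseq_tuple d 0%R) sigma [set x | psi x = true]
          <= (eta / 2)%:E)%E /\
       forall theta : d.-tuple R,
         C' * (lambda sigma + nu sigma) <= linf theta ->
         (gaussian theta sigma [set x | psi x = false] <= (eta / 2)%:E)%E)].
Proof.
(* [c0] makes the risk bound [1 - 2 * c0 = (1 + eta) / 2] exceed [eta]; [C] makes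
   [64 / C^4 = eta^4 / 4], below [eta / 2]. *)
pose c0 := (1 - eta) / 4; pose C := 4 / eta.
have eta0 : eta != 0 by rewrite gt_eqF.
have c0_gt0 : 0 < c0 by rewrite divr_gt0 // subr_gt0.
have c0_le1 : c0 <= 1 by rewrite /c0; lra.
have C4 : 4 <= C by rewrite ler_pdivlMr //; lra.
have C2 : 2 <= C by lra.
have Ceta : 64 / C ^+ 4 <= eta / 2.
  rewrite (_ : 64 / C ^+ 4 = eta * (eta ^+ 3 / 4)); last by rewrite /C; field.
  rewrite ler_pM2l //.
  have : eta ^+ 3 <= 1 by rewrite exprn_ile1 // ltW.
  by lra.
(* Halving [c0] pays for [lambda + nu <= 2 * lambda]; doubling [C] is the separation that
   [max_test_type2] asks for. *)
exists (c0 / 2), (2 * C), C, (2 * C); split; [lra..|].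
move=> d sigma d1 s0 sdecr.
have l0 := lambda_gt0 d1 s0; have n0 := nu_gt0 d1 s0.
have nl : nu sigma <= lambda sigma.
  by apply: (nu_le_lambda d1 s0 (i := Ordinal d1)) => j; exact: sdecr.
have t0 : 0 < C * (lambda sigma + nu sigma).
  by rewrite mulr_gt0 ?addr_gt0 //; lra.
have type1 : (gaussian (nseq_tuple d 0%R) sigma
    [set x | max_test d (C * (lambda sigma + nu sigma)) x = true]
    <= (eta / 2)%:E)%E.
  apply: le_trans (max_test_type1 s0 (ltW t0)) _; rewrite lee_fin.
  exact: le_trans (sum_tail_le d1 s0 C2) Ceta.
have type2 theta : 2 * C * (lambda sigma + nu sigma) <= linf theta ->
    (gaussian theta sigma
    [set x | max_test d (C * (lambda sigma + nu sigma)) x = false]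
    <= (eta / 2)%:E)%E.
  rewrite -mulrA => /(max_test_type2 s0 t0) /le_trans; apply; rewrite lee_fin.
  exact: le_trans (sum_tail_le d1 s0 C2) Ceta.
split => [s /andP[s1 sd]|//]; split.
  apply: le_ereal_inf_tmp => _ [eps [eps0 opt]] <-; rewrite lee_fin leNgt.
  apply/negP => epslt.
  have epsl : eps <= c0 * lambda sigma.
    apply: le_trans (ltW epslt) _; rewrite -mulrA ler_pM2l //; lra.
  suff : ((1 - 2 * c0)%:E <= opt_risk sigma eps s)%E.
    by move=> /le_trans /(_ opt); rewrite lee_fin /c0; lra.
  by apply: le_ereal_inf_tmp => _ [psi _ <-]; exact: risk_ge.
(* This radius is admissible: the maximum test spends [eta / 2] on each error. *)
apply: ereal_inf_lbound; exists (2 * C * (lambda sigma + nu sigma)) => //.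
split; first by rewrite -mulrA mulr_gt0.
apply: ge_ereal_inf; exists (risk sigma
  (max_test d (C * (lambda sigma + nu sigma)))
  (2 * C * (lambda sigma + nu sigma)) s).
  by exists (max_test d (C * (lambda sigma + nu sigma))).
rewrite [X in X%:E]splitr EFinD; apply: leeD => //.
by apply: ge_ereal_sup => _ [theta [theta_ge _] <-]; exact: type2.
Qed.
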